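(* Let $I\subset(0,\infty)$ be an open interval, let $p\colon I\to\mathbb{R}$ be a smooth function with $p'(\rho)>0$, and put $A(\rho)=\rho^{-1}\sqrt{p'(\rho)}$. Let $Q(\rho)=\int \rho A^{2}(\rho)\,d\rho$ be a fixed antiderivative of $\rho A^2(\rho)$ on $I$ and let $\int Q(\rho)\,d\rho$ denote a fixed antiderivative of $Q$ on $I$. Then for arbitrary real constants $\lambda,\alpha_0,\alpha_2,t_0,x_0$ the two-dimensional manifold $N\subset\mathbb{R}^4(t,x,u,\rho)$ given by the relations (with $u\in\mathbb{R}$, $\rho\in I$) $$t=\frac{\lambda u^{2}}{2}+\alpha_{0}u+\frac{\alpha_{2}}{\rho}+\frac{\lambda}{\rho}\int Q(\rho)\,d\rho+t_{0},$$ $$x=\frac{\lambda u^{3}}{3}-\lambda uQ(\rho)+\frac{\alpha_{0}u^{2}}{2}+\frac{\lambda u}{\rho}\int Q(\rho)\,d\rho+\frac{\alpha_{2}u}{\rho}-\alpha_{0}Q(\rho)+x_{0}$$ is a multivalued solution of the system of Euler equations $$\rho_t+(\rho u)_x=0,\qquad u_t+uu_x+\frac{p'(\rho)}{\rho}\rho_x=0 .$$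
   Context: Here $u(t,x)$ is the velocity, $\rho(t,x)>0$ the density and $p=p(\rho)$ the pressure of a gas in one space dimension. On the 0-jet space $E=\mathbb{R}^4$ with coordinates $(t,x,u,\rho)$ (restricted to $\rho\in I$) one associates with the Euler system the differential 2-forms $$\omega_1=\rho\,dt\wedge du+u\,dt\wedge d\rho-dx\wedge d\rho,\qquad \omega_2=u\,dt\wedge du+\frac{p'(\rho)}{\rho}\,dt\wedge d\rho-dx\wedge du .$$ A two-dimensional submanifold $N\subset E$ is called a (multivalued) solution of the system if $\omega_1|_N=\omega_2|_N=0$. (When $N$ is the graph of a vector-function $(u(t,x),\rho(t,x))$, this is equivalent to $(u,\rho)$ being a classical solution.) *)

(* Defs.v *)
From HB Require Import structures.
From mathcomp Require Import all_boot all_order all_algebra.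
From mathcomp Require Import all_classical all_reals all_analysis.
Set Implicit Arguments.
Unset Strict Implicit.
Unset Printing Implicit Defensive.
Import Order.TTheory GRing.Theory Num.Theory.
Import numFieldNormedType.Exports.
Local Open Scope classical_set_scope.
Local Open Scope ring_scope.

(* The definition by directional derivatives is the usual notion of a C^k map
   when V is finite-dimensional and D is open (the only case used here); f may
   take arbitrary values outside D. *)
Fixpoint Ck_on (R : realType) (V W : normedModType R) (k : nat) (D : set V)
    (f : V -> W) : Prop :=
  match k with
  | 0 => forall x, D x -> {for x, continuous f}
  | k'.+1 => (forall x, D x -> differentiable f x) /\
             (forall v : V, Ck_on k' D (fun x => 'D_v f x))
  end.

Definition smooth_on (R : realType) (V W : normedModType R) (D : set V)
    (f : V -> W) : Prop := forall k, Ck_on k D f.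

Definition diffeomorphism (R : realType) (V W : normedModType R)
    (A : set V) (B : set W) (f : V -> W) (g : W -> V) : Prop :=
  [/\ open A /\ open B,
      smooth_on A f /\ smooth_on B g,
      (forall x, A x -> B (f x) /\ g (f x) = x) &
      (forall y, B y -> A (g y) /\ f (g y) = y)].

(* N is an embedded m-dimensional submanifold of R^n: near each of its points
   some chart of R^n straightens N to the slice R^m x {0}. *)
Definition submanifold (R : realType) (n m : nat) (N : set 'rV[R]_n) : Prop :=
  forall a, N a -> exists (A B : set 'rV[R]_n) (f g : 'rV[R]_n -> 'rV[R]_n),
    [/\ A a, diffeomorphism A B f g &
        forall x, A x -> (N x <-> forall i : 'I_n, (m <= i)%N -> f x ord0 i = 0)].

Definition tangent (R : realType) (n : nat) (N : set 'rV[R]_n)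
    (a v : 'rV[R]_n) : Prop :=
  exists (e : R) (c : R -> 'rV[R]_n),
    [/\ 0 < e, smooth_on `]-e, e[%classic c, (forall s, -e < s < e -> N (c s)),
        c 0 = a & derive1 c 0 = v].

Definition form1 (R : realType) (n : nat) := 'rV[R]_n -> 'rV[R]_n -> R.
Definition form2 (R : realType) (n : nat) := 'rV[R]_n -> 'rV[R]_n -> 'rV[R]_n -> R.

Definition ext_d (R : realType) (n : nat) (f : 'rV[R]_n -> R) : form1 R n :=
  fun a v => 'd f a v.

Definition wedge (R : realType) (n : nat) (al be : form1 R n) : form2 R n :=
  fun a v w => al a v * be a w - al a w * be a v.

(* omega|_N = 0 for the pull-back of omega to N. *)
Definition vanishes_on (R : realType) (n : nat) (N : set 'rV[R]_n)
    (omega : form2 R n) : Prop :=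
  forall a v w, N a -> tangent N a v -> tangent N a w -> omega a v w = 0.

(* The coordinates (t, x, u, rho) of R^4. *)
Definition tc (R : realType) (e : 'rV[R]_4) : R := e ord0 (@Ordinal 4 0 isT).
Definition xc (R : realType) (e : 'rV[R]_4) : R := e ord0 (@Ordinal 4 1 isT).
Definition uc (R : realType) (e : 'rV[R]_4) : R := e ord0 (@Ordinal 4 2 isT).
Definition rhoc (R : realType) (e : 'rV[R]_4) : R := e ord0 (@Ordinal 4 3 isT).

Definition omega1 (R : realType) : form2 R 4 := fun a v w =>
  rhoc a * wedge (ext_d (@tc R)) (ext_d (@uc R)) a v w
  + uc a * wedge (ext_d (@tc R)) (ext_d (@rhoc R)) a v w
  - wedge (ext_d (@xc R)) (ext_d (@rhoc R)) a v w.

Definition omega2 (R : realType) (p : R -> R) : form2 R 4 := fun a v w =>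
  uc a * wedge (ext_d (@tc R)) (ext_d (@uc R)) a v w
  + derive1 p (rhoc a) / rhoc a * wedge (ext_d (@tc R)) (ext_d (@rhoc R)) a v w
  - wedge (ext_d (@xc R)) (ext_d (@uc R)) a v w.

(* Multivalued solutions of the Euler system
     rho_t + (rho u)_x = 0,   u_t + u u_x + (p'(rho) / rho) rho_x = 0
   with pressure p : I -> R. *)
Definition multivalued_solution (R : realType) (I : set R) (p : R -> R)
    (N : set 'rV[R]_4) : Prop :=
  [/\ forall e, N e -> I (rhoc e),
      submanifold 2 N,
      vanishes_on N (@omega1 R) &
      vanishes_on N (omega2 p)].

Definition Acoef (R : realType) (p : R -> R) (rho : R) : R :=
  rho^-1 * Num.sqrt (derive1 p rho).

Definition antiderivative_on (R : realType) (I : set R) (f F : R -> R) : Prop :=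
  forall x, I x -> is_derive x 1 F (f x).

(* Main.v *)
Require Import Defs.
From HB Require Import structures.
From mathcomp Require Import all_boot all_order all_algebra.
From mathcomp Require Import all_classical all_reals all_analysis.
From mathcomp Require Import ring.
Set Implicit Arguments.
Unset Strict Implicit.
Unset Printing Implicit Defensive.
Import Order.TTheory GRing.Theory Num.Theory.
Import numFieldNormedType.Exports.
Local Open Scope classical_set_scope.
Local Open Scope ring_scope.

(** N is the graph of (t, x) = (T(u, rho), X(u, rho)), so it is straightened by
    (t, x, u, rho) |-> (u, rho, t - T(u, rho), x - X(u, rho)); T and X are smooth
    because Q' = rho A^2 = p' / rho is.  On the graph,
    omega_1 = (u T_u - rho T_rho - X_u) du /\ drho and
    omega_2 = ((p' / rho) T_u - u T_rho + X_rho) du /\ drho,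
    and both coefficients vanish identically. *)

(** * Calculus of C^k maps on open sets *)

Lemma near_eq_differentiable (R : realType) (V W : normedModType R)
    (f g : V -> W) (x : V) :
  (\forall y \near x, f y = g y) -> differentiable f x -> differentiable g x.
Proof.
move=> fg df.
(* The difference [h] vanishes near [x], so the zero map serves as its differential, and [g = f + h]
   is a sum of differentiable maps. *)
pose h := g \- f.
pose z : {linear V -> W} := \0.
have zc : continuous z by move=> y; exact: cst_continuous.
have ho : h \o shift x = cst (h x) + z +o_ 0 id.
  apply/eqaddoP => _/posnumP[e]; near=> y.
  rewrite /= -![(_ + _) y]/(_ y + _ y) /= /h /=.
  have -> : g (y + x) = f (y + x).
    near: y; have := fg; rewrite (near_shift 0 x) /= => fg'.
    by near=> y; apply/esym; rewrite -[X in y + X]subr0; near: y; exact: fg'.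
  by rewrite (nbhs_singleton fg) !subrr !(addr0, subrr, oppr0) normr0 mulr_ge0.
have dh : differentiable h x.
  by apply/diff_locallyP; rewrite (diff_unique zc ho).
rewrite (_ : g = f + h); first exact: differentiableD.
by apply/funext => y; rewrite /h -![(_ + _) y]/(_ y + _ y) /= addrC subrK.
Unshelve. all: by end_near. Qed.

Section Ck_calculus.
Context (R : realType).
Implicit Types V W : normedModType R.

(** Openness of [D] upgrades equality on [D] to equality near each of its points, so directional
    derivatives agree on [D] too and the induction passes to them. This lets the differentiation
    rules below be applied although they hold only on [D]. *)
Lemma Ck_on_eq V W k (D : set V) (f g : V -> W) : open D ->
  (forall x, D x -> f x = g x) -> Ck_on k D f -> Ck_on k D g.
Proof.
move=> oD; elim: k f g => [|k IH] f g fg /=.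
  move=> fc x Dx; rewrite /prop_for /continuous_at -(fg _ Dx).
  apply: cvg_trans (fc x Dx); apply: near_eq_cvg.
  by near do apply: fg; exact: open_nbhs_nbhs.
have nfg x : D x -> \forall y \near x, f y = g y.
  by move=> Dx; near do apply: fg; exact: open_nbhs_nbhs.
move=> [df Df]; split => [x Dx|v].
  exact: near_eq_differentiable (nfg _ Dx) (df _ Dx).
by apply: IH (Df v) => x Dx; apply: near_eq_derive; exact: nfg.
Unshelve. all: by end_near. Qed.

Lemma Ck_onS V W k (D : set V) (f : V -> W) : Ck_on k.+1 D f -> Ck_on k D f.
Proof.
elim: k f => [|k IH] f [df Df]; first by move=> x /df/differentiable_continuous.
by split=> // v; apply: IH; exact: Df.
Qed.

Lemma Ck_on_cst V W k (D : set V) (a : W) : Ck_on k D (fun=> a : W).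
Proof.
elim: k a => [|k IH] a /=; first by move=> x _; exact: cst_continuous.
split => [x _|v]; first exact: differentiable_cst.
have -> : 'D_v (fun=> a : W) = (fun=> 0 : W) :> (V -> W); last exact: IH.
by apply/funext => x; exact: derive_cst.
Qed.

Lemma Ck_on_linear V W k (D : set V) (f : {linear V -> W}) :
  continuous f -> Ck_on k D f.
Proof.
case: k => [|k] fc /=; first by move=> x _; exact: fc.
split => [x _|v]; first exact: linear_differentiable.
have -> : 'D_v f = (fun=> f v) :> (V -> W); last exact: Ck_on_cst.
by apply/funext => x; rewrite deriveE ?diff_lin //; exact: linear_differentiable.
Qed.

Lemma Ck_on_id k (D : set R) : Ck_on k D (id : R -> R).
Proof.
by apply: (@Ck_on_linear _ _ k D idfun) => x; exact: cvg_id.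
Qed.

Lemma Ck_onD V W k (D : set V) (f g : V -> W) : open D ->
  Ck_on k D f -> Ck_on k D g -> Ck_on k D (fun x => f x + g x).
Proof.
move=> oD; elim: k f g => [|k IH] f g /=.
  by move=> fc gc x Dx; apply: continuousD; [exact: fc | exact: gc].
move=> [df Df] [dg Dg]; split => [x Dx|v].
  by apply: differentiableD; [exact: df | exact: dg].
apply: Ck_on_eq (IH _ _ (Df v) (Dg v)) => // x Dx.
by rewrite -[RHS]/('D_v (f + g) x) deriveD //; apply: diff_derivable;
  [exact: df | exact: dg].
Qed.

Lemma Ck_onM V k (D : set V) (f g : V -> R) : open D ->
  Ck_on k D f -> Ck_on k D g -> Ck_on k D (fun x => f x * g x).
Proof.
move=> oD; elim: k f g => [|k IH] f g.
  by move=> fc gc x Dx; apply: continuousM; [exact: fc | exact: gc].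
move=> Cf Cg; have [[df Df] [dg Dg]] := (Cf, Cg); split => [x Dx|v].
  by apply: differentiableM; [exact: df | exact: dg].
(* The product rule also contains [f] and [g] themselves; [Ck_onS] lowers their order to match that
   of the derivatives. *)
have := Ck_onD oD (IH _ _ (Ck_onS Cf) (Dg v)) (IH _ _ (Ck_onS Cg) (Df v)).
apply: Ck_on_eq => // x Dx.
by rewrite -[RHS]/('D_v (f * g) x) deriveM //; apply: diff_derivable;
  [exact: df | exact: dg].
Qed.

Lemma Ck_onN V k (D : set V) (f : V -> R) : open D ->
  Ck_on k D f -> Ck_on k D (fun x => - f x).
Proof.
move=> oD Cf; have := Ck_onM oD (@Ck_on_cst _ _ k D (-1 : R)) Cf.
by apply: Ck_on_eq => // x _; rewrite mulN1r.
Qed.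

Lemma Ck_onB V k (D : set V) (f g : V -> R) : open D ->
  Ck_on k D f -> Ck_on k D g -> Ck_on k D (fun x => f x - g x).
Proof. by move=> oD Cf Cg; apply: Ck_onD => //; exact: Ck_onN. Qed.

Lemma Ck_onX V k (D : set V) (f : V -> R) n : open D ->
  Ck_on k D f -> Ck_on k D (fun x => f x ^+ n).
Proof.
move=> oD Cf; elim: n => [|n IH]; first exact: Ck_on_cst.
by under [X in Ck_on _ _ X]eq_fun do rewrite exprS; exact: Ck_onM.
Qed.

(** The derivative of 1/f along v is - (1/f)^2 D_v f, a product of C^k functions once 1/f is C^k by
    induction. *)
Lemma Ck_onV V k (D : set V) (f : V -> R) : open D ->
  (forall x, D x -> f x != 0) -> Ck_on k D f -> Ck_on k D (fun x => (f x)^-1).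
Proof.
move=> oD f0; elim: k => [|k IH] => [fc x Dx|Cf].
  by apply: continuousV; [exact: f0 | exact: fc].
have [df Df] := Cf; split => [x Dx|v].
  by apply: differentiableV; [exact: df | exact: f0].
have CV := IH (Ck_onS Cf).
have := Ck_onM oD (Ck_onN oD (Ck_onX 2 oD CV)) (Df v).
apply: Ck_on_eq => // x Dx.
by rewrite deriveV ?exprVn //; [exact: f0 | exact/diff_derivable/df].
Qed.

Lemma Ck_onZl V W k (D : set V) (f : V -> R) (w : W) : open D ->
  Ck_on k D f -> Ck_on k D (fun x => f x *: w).
Proof.
move=> oD; elim: k f => [|k IH] f /=.
  by move=> fc x Dx; apply: continuousZr_tmp; exact: fc.
move=> [df Df]; split => [x Dx|v]; first by apply: differentiableZl; exact: df.
apply: Ck_on_eq (IH _ (Df v)) => // x Dx.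
have dfx := df _ Dx.
by rewrite [RHS]deriveE ?diffZl ?deriveE //; exact: differentiableZl.
Qed.

(** Chain rule D_v (h o f) = (h' o f) D_v f with h' = ['D_1 h]; the induction keeps [f] fixed and
    replaces [h] by h'. *)
Lemma Ck_on_comp V k (D : set V) (I : set R) (f : V -> R) (h : R -> R) :
  open D -> (forall x, D x -> I (f x)) ->
  Ck_on k D f -> Ck_on k I h -> Ck_on k D (fun x => h (f x)).
Proof.
move=> oD DI; elim: k h => [|k IH] h.
  move=> fc hc x Dx; apply: continuous_comp; first exact: fc.
  by apply: hc; exact: DI.
move=> Cf [dh Dh]; have [df Df] := Cf; split => [x Dx|v].
  by apply: (@differentiable_comp _ _ _ _ f h); [exact: df | exact/dh/DI].
have := Ck_onM oD (IH _ (Ck_onS Cf) (Dh 1)) (Df v).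
apply: Ck_on_eq => // x Dx.
have [dfx dhx] := (df _ Dx, dh _ (DI _ Dx)).
rewrite -[RHS]/('D_v (h \o f) x) !deriveE //; last exact: differentiable_comp.
rewrite [in RHS](diff_comp dfx dhx) mulrC.
by rewrite -[LHS]/('d f x v *: 'd h (f x) (1 : R)) -linearZ [_ *: _]mulr1.
Qed.

End Ck_calculus.

(** * C^k maps into spaces of row vectors *)

Section Ck_matrix.
Context (R : realType).
Implicit Types V : normedModType R.

(** A named projection, to which the linear structure below can be attached. *)
Definition mx_coord m n (i : 'I_m) (j : 'I_n) (M : 'M[R]_(m, n)) : R := M i j.

Lemma mx_coord_linear m n (i : 'I_m) (j : 'I_n) : linear (mx_coord i j).
Proof. by move=> a M N; rewrite /mx_coord !mxE. Qed.

HB.instance Definition _ m n (i : 'I_m) (j : 'I_n) :=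
  GRing.isLinear.Build R 'M[R]_(m, n) R _ (mx_coord i j)
    (@mx_coord_linear m n i j).

Lemma Ck_on_coord n k (D : set 'rV[R]_n) (i : 'I_1) (j : 'I_n) :
  Ck_on k D (fun M : 'rV[R]_n => M i j : R).
Proof.
by apply: (@Ck_on_linear _ _ _ k D (mx_coord i j)); exact: coord_continuous.
Qed.

Lemma ext_d_coord n (j : 'I_n) (a v : 'rV[R]_n) :
  ext_d (fun M : 'rV[R]_n => M ord0 j : R) a v = v ord0 j.
Proof.
rewrite /ext_d -[fun M => _]/(mx_coord ord0 j) diff_lin //.
exact: coord_continuous.
Qed.

(** Expand [f] in the standard basis: each term is a C^k scalar times a constant vector. *)
Lemma Ck_on_row V n k (D : set V) (f : V -> 'rV[R]_n) : open D ->
  (forall j, Ck_on k D (fun x => f x ord0 j)) -> Ck_on k D f.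
Proof.
move=> oD Cf.
have : Ck_on k D (fun x => \sum_(j <- index_enum 'I_n) f x ord0 j *: ('e_j : 'rV[R]_n)).
  elim: (index_enum _) => [|j s IH].
    by apply: Ck_on_eq (Ck_on_cst k D (0 : 'rV[R]_n)) => // x _; rewrite big_nil.
  apply: Ck_on_eq (Ck_onD oD (Ck_onZl ('e_j : 'rV[R]_n) oD (Cf j)) IH) => // x _.
  by rewrite big_cons.
by apply: Ck_on_eq => // x _; rewrite [RHS]row_sum_delta.
Qed.

End Ck_matrix.

(** * Graphs over the (u, rho) plane as submanifolds of R^4 *)

Section graph.
Context (R : realType).

Definition row4 (a b c d : R) : 'rV[R]_4 := \row_(i < 4) [:: a; b; c; d]`_i.

Lemma tc_row4 a b c d : tc (row4 a b c d) = a.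
Proof. by rewrite /tc mxE. Qed.

Lemma xc_row4 a b c d : xc (row4 a b c d) = b.
Proof. by rewrite /xc mxE. Qed.

Lemma uc_row4 a b c d : uc (row4 a b c d) = c.
Proof. by rewrite /uc mxE. Qed.

Lemma rhoc_row4 a b c d : rhoc (row4 a b c d) = d.
Proof. by rewrite /rhoc mxE. Qed.

Definition row4E :=
  (tc_row4, xc_row4, uc_row4, rhoc_row4).

Lemma row4_coords (e : 'rV[R]_4) : row4 (tc e) (xc e) (uc e) (rhoc e) = e.
Proof.
by apply/rowP => -[[|[|[|[|//]]]] i]; rewrite mxE /=; congr (e _ _); exact: val_inj.
Qed.

Lemma Ck_on_row4 k (D : set 'rV[R]_4) (a b c d : 'rV[R]_4 -> R) : open D ->
  Ck_on k D a -> Ck_on k D b -> Ck_on k D c -> Ck_on k D d ->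
  Ck_on k D (fun e => row4 (a e) (b e) (c e) (d e)).
Proof.
move=> oD Ca Cb Cc Cd; apply: Ck_on_row => // -[[|[|[|[|//]]]] i];
under [X in Ck_on _ _ X]eq_fun do rewrite mxE /=; by [].
Qed.

(** Smoothness of [T] and [X] is stated through composition with arbitrary C^k functions [a], [b],
    which avoids C^k maps on a product: the chart needs (a, b) = (u, rho), its inverse the first two
    slots. One chart serves all points. *)
Lemma submanifold_graph (I : set R) (T X : R -> R -> R) : open I ->
  (forall k (D : set 'rV[R]_4) (a b : 'rV[R]_4 -> R), open D ->
     (forall e, D e -> I (b e)) -> Ck_on k D a -> Ck_on k D b ->
     Ck_on k D (fun e => T (a e) (b e)) /\ Ck_on k D (fun e => X (a e) (b e))) ->
  submanifold 2 [set e : 'rV[R]_4 |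
    [/\ I (rhoc e), tc e = T (uc e) (rhoc e) & xc e = X (uc e) (rhoc e)]].
Proof.
move=> oI CTX a [Ia _ _].
pose A := [set e : 'rV[R]_4 | I (rhoc e)].
(* The chart stores u in slot [tc] and rho in slot [xc], so its image is cut out by a condition on
   [xc]; the last two slots vanish exactly on the graph. *)
pose B := [set e : 'rV[R]_4 | I (xc e)].
pose f (e : 'rV[R]_4) := row4 (uc e) (rhoc e)
  (tc e - T (uc e) (rhoc e)) (xc e - X (uc e) (rhoc e)).
pose g (e : 'rV[R]_4) := row4 (uc e + T (tc e) (xc e))
  (rhoc e + X (tc e) (xc e)) (tc e) (xc e).
have oA : open A.
  by apply: (@open_comp _ _ (fun e : 'rV[R]_4 => rhoc e : R)) => // e _;
    exact: coord_continuous.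
have oB : open B.
  by apply: (@open_comp _ _ (fun e : 'rV[R]_4 => xc e : R)) => // e _;
    exact: coord_continuous.
exists A, B, f, g; split => //.
  split => //.
  - split => k.
    + have [CT CX] := CTX k A (@uc R) (@rhoc R) oA (fun _ => id)
        (Ck_on_coord _ _ _ _) (Ck_on_coord _ _ _ _).
      by apply: Ck_on_row4 => //; try apply: Ck_onB => //; exact: Ck_on_coord.
    + have [CT CX] := CTX k B (@tc R) (@xc R) oB (fun _ => id)
        (Ck_on_coord _ _ _ _) (Ck_on_coord _ _ _ _).
      by apply: Ck_on_row4 => //; try apply: Ck_onD => //; exact: Ck_on_coord.
  - move=> e Ae; split; first by rewrite /B /= row4E.
    by rewrite /g !row4E !subrK row4_coords.
  - move=> e Be; split; first by rewrite /A /= row4E.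
    by rewrite /f !row4E !addrK row4_coords.
move=> e Ae; split => [[_ et ex] [[|[|[|[|//]]]] i] //= _|fe].
- by rewrite mxE /= et subrr.
- by rewrite mxE /= ex subrr.
- split => //; apply/eqP; rewrite -subr_eq0; apply/eqP.
    by have := fe (@Ordinal 4 2 isT) isT; rewrite mxE.
  by have := fe (@Ordinal 4 3 isT) isT; rewrite mxE.
Qed.

End graph.

Lemma ext_d_coordE (R : realType) :
  (forall a v : 'rV[R]_4, ext_d (@tc R) a v = tc v) *
  (forall a v : 'rV[R]_4, ext_d (@xc R) a v = xc v) *
  (forall a v : 'rV[R]_4, ext_d (@uc R) a v = uc v) *
  (forall a v : 'rV[R]_4, ext_d (@rhoc R) a v = rhoc v).
Proof. by do 3?[split]=> a v; exact: ext_d_coord. Qed.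

(** * Smoothness of antiderivatives and derivatives on an open set *)

Section antiderivative.
Context (R : realType) (I : set R) (I_open : open I).

Lemma Ck_on_antiderivative k (f F : R -> R) : antiderivative_on I f F ->
  Ck_on k I f -> Ck_on k.+1 I F.
Proof.
move=> FI Cf.
have dF x : I x -> differentiable F x.
  by move=> Ix; apply/derivable1_diffP; case: (FI _ Ix).
split => // v; apply: Ck_on_eq (Ck_onZl (v : R) I_open Cf) => // x Ix.
rewrite deriveE; last exact: dF.
rewrite -[v in RHS]mulr1 [RHS]linearZ -deriveE; last exact: dF.
by rewrite (@derive_val _ _ _ _ _ _ _ (FI _ Ix)) [RHS]mulrC.
Qed.

Lemma smooth_on_antiderivative (f F : R -> R) : antiderivative_on I f F ->
  smooth_on I f -> smooth_on I F.
Proof. by move=> FI Cf k; apply/Ck_onS/(Ck_on_antiderivative FI)/Cf. Qed.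

Lemma smooth_on_derive1 (f : R -> R) : smooth_on I f -> smooth_on I (derive1 f).
Proof.
move=> Cf k; have [_ /(_ 1)] := Cf k.+1.
by apply: Ck_on_eq => // x _; rewrite derive1E.
Qed.

End antiderivative.

(** * Tangent vectors, and the surface of the theorem *)

(** Reduces tangency to one-variable calculus, coordinate by coordinate; order 1 of the smoothness
    of the curve suffices. *)
Lemma tangent_is_derive (R : realType) n (N : set 'rV[R]_n) (a v : 'rV[R]_n) :
  tangent N a v -> exists c : R -> 'rV[R]_n,
    [/\ \forall s \near (0 : R), N (c s), c 0 = a &
        forall j, is_derive (0 : R) 1 (fun s => c s ord0 j) (v ord0 j)].
Proof.
case=> e [c [e0 cs Nc c0 cv]]; exists c; split => //.
  by apply: filterS (nbhs0_lt e0) => s; rewrite ltr_norml; exact: Nc.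
have [dc _] := cs 1%N.
have dc0 : derivable c 0 1.
  by apply/derivable1_diffP/dc; rewrite /= in_itv /= e0 oppr_lt0 e0.
move=> j; apply: DeriveDef; first by move/derivable_mxP : dc0; exact.
by rewrite -cv derive1E derive_mx // mxE.
Qed.

Section Euler.
Context (R : realType) (I : set R).
Context (I_open : open I) (I_pos : I `<=` `]0, +oo[).
Context (p Q IQ : R -> R) (lambda alpha0 alpha2 t0 x0 : R).
Context (p_smooth : smooth_on I p)
  (dp_pos : forall rho, I rho -> 0 < derive1 p rho)
  (Q_anti : antiderivative_on I (fun rho => rho * Acoef p rho ^+ 2) Q)
  (IQ_anti : antiderivative_on I Q IQ).

Let T (u rho : R) := lambda * u ^+ 2 / 2 + alpha0 * u + alpha2 / rho
  + lambda / rho * IQ rho + t0.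
Let X (u rho : R) := lambda * u ^+ 3 / 3 - lambda * u * Q rho
  + alpha0 * u ^+ 2 / 2 + lambda * u / rho * IQ rho + alpha2 * u / rho
  - alpha0 * Q rho + x0.

Lemma rho_neq0 rho : I rho -> rho != 0.
Proof. by move=> /I_pos; rewrite /= in_itv /= andbT => /lt0r_neq0. Qed.

(** Identifies Q' with the coefficient p' / rho of [omega2]; positivity of p' removes the square
    root. *)
Lemma rho_Acoef_sqr rho : I rho ->
  rho * Acoef p rho ^+ 2 = derive1 p rho / rho.
Proof.
move=> Ir; have := rho_neq0 Ir => r0.
rewrite /Acoef exprMn sqr_sqrtr; last exact/ltW/dp_pos.
by field.
Qed.

Lemma Q_smooth : smooth_on I Q.
Proof.
apply: smooth_on_antiderivative Q_anti _ => // k.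
have Cinv : Ck_on k I (fun r : R => r^-1).
  by apply: Ck_onV => //; [exact: rho_neq0 | exact: Ck_on_id].
have := Ck_onM I_open (smooth_on_derive1 I_open p_smooth k) Cinv.
by apply: Ck_on_eq => // r Ir; rewrite rho_Acoef_sqr.
Qed.

Lemma Ck_on_TX k (D : set 'rV[R]_4) (a b : 'rV[R]_4 -> R) : open D ->
  (forall e, D e -> I (b e)) -> Ck_on k D a -> Ck_on k D b ->
  Ck_on k D (fun e => T (a e) (b e)) /\ Ck_on k D (fun e => X (a e) (b e)).
Proof.
move=> oD DI Ca Cb.
have CQ : Ck_on k D (fun e => Q (b e)) by apply: Ck_on_comp DI Cb (Q_smooth k).
have CIQ : Ck_on k D (fun e => IQ (b e)).
  have CIQ := smooth_on_antiderivative I_open IQ_anti Q_smooth k.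
  exact: Ck_on_comp DI Cb CIQ.
have CV : Ck_on k D (fun e => (b e)^-1).
  by apply: Ck_onV => // e /DI /rho_neq0.
by split; rewrite /T /X; repeat first [exact: Ck_on_cst | assumption
  | apply: Ck_onX | apply: Ck_onB | apply: Ck_onD | apply: Ck_onM].
Qed.

(* [k], [Tu], [Tr], [Xu], [Xr] are Q' and the partial derivatives of T and X,
   the latter already rewritten through the former. *)
Lemma tangent_TX (a v : 'rV[R]_4) :
  tangent [set e : 'rV[R]_4 |
    [/\ I (rhoc e), tc e = T (uc e) (rhoc e) & xc e = X (uc e) (rhoc e)]] a v ->
  let u := uc a in let rho := rhoc a in let k := derive1 p rho / rho in
  let Tu := lambda * u + alpha0 in
  let Tr := lambda * Q rho / rho - (lambda * IQ rho + alpha2) / rho ^+ 2 in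
  let Xu := u * Tu - rho * Tr in
  let Xr := u * Tr - k * Tu in
  I rho ->
  tc v = Tu * uc v + Tr * rhoc v /\ xc v = Xu * uc v + Xr * rhoc v.
Proof.
move=> /tangent_is_derive[c [Nc ca dc]] u rho k Tu Tr Xu Xr Ir.
pose U s := uc (c s); pose P s := rhoc (c s).
have U0 : U 0 = u by rewrite /U ca.
have P0 : P 0 = rho by rewrite /P ca.
have r0 := rho_neq0 Ir.
have dU : is_derive (0 : R) 1 U (uc v) by exact: dc.
have dP : is_derive (0 : R) 1 P (rhoc v) by exact: dc.
have dQ : is_derive (0 : R) 1 (Q \o P) (k * rhoc v).
  apply: is_derive1_comp; rewrite P0 /k -rho_Acoef_sqr //; exact: Q_anti.
have dIQ : is_derive (0 : R) 1 (IQ \o P) (Q rho * rhoc v).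
  by apply: is_derive1_comp; rewrite P0; exact: IQ_anti.
have dV : is_derive (0 : R) 1 (fun s => (P s)^-1) (- rho ^- 2 * rhoc v).
  by rewrite -P0; apply: is_deriveV; rewrite P0.
split.
  rewrite -[LHS](@derive_val _ _ _ _ _ _ _ (dc _)).
  (* The curve satisfies t = T(u, rho) only near 0, which is enough for the derivative there. T is
     rewritten with constants, products and compositions so that its derivative is inferred from
     [dU], [dP], [dIQ] and [dV]. *)
  have -> : 'D_1 (fun s => c s ord0 (@Ordinal 4 0 isT)) (0 : R) =
      'D_1 (cst (lambda / 2) * (U * U) + cst alpha0 * U
        + cst alpha2 * (fun s => (P s)^-1)
        + cst lambda * ((fun s => (P s)^-1) * (IQ \o P)) + cst t0) (0 : R).
    apply: near_eq_derive; near=> s.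
    have [_ + _] : [/\ I (P s), tc (c s) = T (U s) (P s) & xc (c s) = X (U s) (P s)].
      by near: s.
    rewrite /tc => ->; rewrite /T !fctE /=; ring.
  rewrite derive_val /GRing.scale /= !fctE /= U0 P0 /Tu /Tr.
  by field.
rewrite -[LHS](@derive_val _ _ _ _ _ _ _ (dc _)).
have -> : 'D_1 (fun s => c s ord0 (@Ordinal 4 1 isT)) (0 : R) =
    'D_1 (cst (lambda / 3) * (U * (U * U)) - cst lambda * (U * (Q \o P))
      + cst (alpha0 / 2) * (U * U)
      + cst lambda * (U * ((fun s => (P s)^-1) * (IQ \o P)))
      + cst alpha2 * (U * (fun s => (P s)^-1))
      - cst alpha0 * (Q \o P) + cst x0) (0 : R).
  apply: near_eq_derive; near=> s.
  have [_ _] : [/\ I (P s), tc (c s) = T (U s) (P s) & xc (c s) = X (U s) (P s)].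
    by near: s.
  rewrite /xc => ->; rewrite /X !fctE /=; ring.
(* Differentiating X in u gives lambda u^2 + alpha0 u - lambda Q + (lambda IQ + alpha2) / rho, which
   is u T_u - rho T_rho; in rho it gives u T_rho - k T_u, the term in k coming from Q'. *)
rewrite derive_val /GRing.scale /= !fctE /= U0 P0 /Xu /Xr /Tu /Tr.
by field.
Unshelve. all: by end_near. Qed.

End Euler.

(* IQ is the fixed antiderivative of Q. *)
Theorem mainTheorem1 (R : realType) (I : set R)
    (I_open : open I) (I_interval : is_interval I) (I_pos : I `<=` `]0, +oo[)
    (p : R -> R) (p_smooth : smooth_on I p)
    (dp_pos : forall rho, I rho -> 0 < derive1 p rho)
    (Q IQ : R -> R)
    (Q_anti : antiderivative_on I (fun rho => rho * Acoef p rho ^+ 2) Q)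
    (IQ_anti : antiderivative_on I Q IQ)
    (lambda alpha0 alpha2 t0 x0 : R) :
  multivalued_solution I p
    [set e : 'rV[R]_4 |
      let u := uc e in let rho := rhoc e in
      [/\ I rho,
          tc e = lambda * u ^+ 2 / 2 + alpha0 * u + alpha2 / rho
                 + lambda / rho * IQ rho + t0 &
          xc e = lambda * u ^+ 3 / 3 - lambda * u * Q rho + alpha0 * u ^+ 2 / 2
                 + lambda * u / rho * IQ rho + alpha2 * u / rho
                 - alpha0 * Q rho + x0]].
Proof.
split.
- by move=> e [].
- exact: submanifold_graph I_open
    (@Ck_on_TX _ _ I_open I_pos _ _ _ lambda alpha0 alpha2 t0 x0
       p_smooth dp_pos Q_anti IQ_anti).
- move=> a v w [Ia _ _].
  move=> /(tangent_TX I_pos dp_pos Q_anti IQ_anti)/(_ Ia)[tv xv].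
  move=> /(tangent_TX I_pos dp_pos Q_anti IQ_anti)/(_ Ia)[tw xw].
  have r0 := rho_neq0 I_pos Ia.
  (* The du /\ drho coefficient cancels because X_u = u T_u - rho T_rho. *)
  rewrite /omega1 /wedge !ext_d_coordE tv tw xv xw; by field.
- move=> a v w [Ia _ _].
  move=> /(tangent_TX I_pos dp_pos Q_anti IQ_anti)/(_ Ia)[tv xv].
  move=> /(tangent_TX I_pos dp_pos Q_anti IQ_anti)/(_ Ia)[tw xw].
  have r0 := rho_neq0 I_pos Ia.
  (* Here the cancellation is X_rho = u T_rho - (p' / rho) T_u. *)
  rewrite /omega2 /wedge !ext_d_coordE tv tw xv xw; by field.
Qed.
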